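(* Let $\Omega=[Y_i,Y_j;Y]$ be a triad at an X-point $p=Y_i\bowtie Y_j$, and let $(\mu,f)$ be the pair given by the symmetry of $\Omega$, so that $f(\Omega(x))=\Omega(\mu(x))$ for all $x$ sufficiently close to $p$. A piecewise-affine function $W$ which is regular near $p$ except, possibly, at $p$, satisfies $$W(\mu(x))=f(W(x))$$ for all $x$ sufficiently close to $p$ if and only if (near $p$) $W$ is an affine combination of functions in $\Omega^{\updownarrow}:=[\max\{Y_i,Y_j\},\min\{Y_i,Y_j\},Y]$.
   Context: All functions are piecewise-affine continuous real functions of one variable with rational coefficients and finitely many pieces on any interval; such a function is regular at a point if it is affine near it. If $(p-\epsilon,p+\epsilon)\cap\{x\in\mathbb{Q}:Y_i(x)=Y_j(x)\}=\{p\}$ for some $\epsilon>0$ and $p\in\mathbb{Q}$, we write $p=Y_i\bowtie Y_j$ and call $p$ an X-point. A triad $\Omega=[Y_i,Y_j;Y]$ consists of $Y_i,Y_j$ and an auxiliary function $Y$, a piecewise-affine function not through $(p,Y_i(p))$ (here lying above it), all three being regular near $p$ except possibly at $p$. With $U=\max\{Y_i,Y_j\}$ and $L=\min\{Y_i,Y_j\}$, write near $p$: $[U,L;Y]=[I,J;K]$ for $x\geqslant p$ and $[U,L;Y]=[I',J';K']$ for $x<p$, where $I,J,K,I',J',K'$ are affine functions. The pair $(\mu,f)$ of the triad is, for $x\geqslant p$, $$\mu=\left(\frac{K'-I'}{K'-J'}\right)^{-1}\circ\frac{K-I}{K-J},\qquad f(z)=\frac{K'(\mu(x))-I'(\mu(x))}{K(x)-I(x)}z+\frac{K(x)I'(\mu(x))-I(x)K'(\mu(x))}{K(x)-I(x)}$$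 (inverse as a M\''obius map; $f$ is affine in $z$ with coefficients depending on $x$), and, for $x<p$, the inverse pair obtained by interchanging primed and unprimed quantities. It satisfies $U(\mu(x))=f(U(x))$, $L(\mu(x))=f(L(x))$, $Y(\mu(x))=f(Y(x))$ for $x$ near $p$. An affine combination of functions is a linear combination with constant real coefficients adding up to $1$. *)

(* Defs.v *)
From mathcomp Require Import all_boot all_order all_algebra.
From mathcomp Require Import all_classical all_reals all_analysis.

Set Implicit Arguments.
Unset Strict Implicit.
Unset Printing Implicit Defensive.

Import Order.TTheory GRing.Theory Num.Theory.
Import numFieldNormedType.Exports.

Local Open Scope classical_set_scope.
Local Open Scope ring_scope.

Definition rat_affine_on (R : realType) (A : set R) (F : R -> R) : Prop :=
  exists m q : rat, forall x, A x -> F x = ratr m * x + ratr q.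

(* The partition of [a, b] is a < s_0 < ... < s_(n-1) = b (a is not in s), and
   F is affine with rational coefficients on each closed cell. *)
Definition piecewise_affine (R : realType) (F : R -> R) : Prop :=
  continuous F /\
  forall a b : R, a < b -> exists s : seq R, itv_partition a b s /\
    forall i, (i < size s)%N ->
      rat_affine_on [set` `[nth b (a :: s) i, nth b s i]] F.

Definition regular_at (R : realType) (F : R -> R) (x : R) : Prop :=
  exists m q : R, \forall y \near x, F y = m * y + q.

Definition regular_near_except (R : realType) (F : R -> R) (p : R) : Prop :=
  \forall x \near p^', regular_at F x.

Definition X_point (R : realType) (Yi Yj : R -> R) (p : rat) : Prop :=
  exists2 e : R, 0 < e &
    [set x : rat | ratr p - e < ratr x < ratr p + e /\
                   Yi (ratr x) = Yj (ratr x)] = [set p].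

Record triad (R : realType) (Yi Yj Y : R -> R) (p : rat) : Prop := Triad {
  triad_pwa_i : piecewise_affine Yi;
  triad_pwa_j : piecewise_affine Yj;
  triad_pwa : piecewise_affine Y;
  triad_X_point : X_point Yi Yj p;
  triad_above : Yi (ratr p) < Y (ratr p);
  triad_reg_i : regular_near_except Yi (ratr p);
  triad_reg_j : regular_near_except Yj (ratr p);
  triad_reg : regular_near_except Y (ratr p) }.

(* The affine functions [I, J; K] that represent [U, L; Y] on one side of p.
   Affine functions are polynomials of size at most 2. *)
Record branch (R : realType) : Type := Branch {
  brI : {poly R}; brJ : {poly R}; brK : {poly R} }.

Definition right_piece (R : realType) (p : R) (F : R -> R) (A : {poly R}) :
    Prop :=
  (size A <= 2)%N /\ \forall x \near p, p <= x -> F x = A.[x].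

Definition left_piece (R : realType) (p : R) (F : R -> R) (A : {poly R}) :
    Prop :=
  (size A <= 2)%N /\ \forall x \near p, x < p -> F x = A.[x].

Definition right_branch (R : realType) (p : R) (U L Y : R -> R)
    (T : branch R) : Prop :=
  [/\ right_piece p U (brI T), right_piece p L (brJ T)
    & right_piece p Y (brK T)].

Definition left_branch (R : realType) (p : R) (U L Y : R -> R)
    (T : branch R) : Prop :=
  [/\ left_piece p U (brI T), left_piece p L (brJ T)
    & left_piece p Y (brK T)].

Definition mobius (R : realType) (M : 'M[R]_2) (x : R) : R :=
  (M 0 0 * x + M 0 1) / (M 1 0 * x + M 1 1).

(* The matrix of the Moebius map A / B, for A and B affine: row 0 is
   (A`_1, A`_0) and row 1 is (B`_1, B`_0). *)
Definition quotient_mx (R : realType) (A B : {poly R}) : 'M[R]_2 :=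
  \matrix_(i < 2, j < 2) (if i == 0 then A else B)`_(1 - j)%N.

Definition branch_mx (R : realType) (T : branch R) : 'M[R]_2 :=
  quotient_mx (brK T - brI T) (brK T - brJ T).

(* mu on the side of p represented by T, with T' the opposite side; invmx gives
   the inverse Moebius map. *)
Definition branch_mu (R : realType) (T T' : branch R) (x : R) : R :=
  mobius (invmx (branch_mx T')) (mobius (branch_mx T) x).

Definition branch_f (R : realType) (T T' : branch R) (x z : R) : R :=
  let I := (brI T).[x] in
  let K := (brK T).[x] in
  let I' := (brI T').[branch_mu T T' x] in
  let K' := (brK T').[branch_mu T T' x] in
  (K' - I') / (K - I) * z + (K * I' - I * K') / (K - I).

Definition sym_mu (R : realType) (p : R) (T T' : branch R) (x : R) : R :=
  if p <= x then branch_mu T T' x else branch_mu T' T x.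

Definition sym_f (R : realType) (p : R) (T T' : branch R) (x z : R) : R :=
  if p <= x then branch_f T T' x z else branch_f T' T x z.

Definition affine_combination_near (R : realType) (p : R) (W U L Y : R -> R) :
    Prop :=
  exists a b c : R, a + b + c = 1 /\
    \forall x \near p, W x = a * U x + b * L x + c * Y x.

(* Main.v *)
Require Import Defs.
From mathcomp Require Import all_boot all_order all_algebra.
From mathcomp Require Import all_classical all_reals all_analysis.
From mathcomp Require Import ring lra.

(** Near p the functions U (the maximum), L (the minimum) and Y are affine on
    each side: [I, J; K] on the right, [I', J'; K'] on the left. All the
    pairs agree at p, where I and J take a common value c and K takes a value
    c + h with h > 0; since Y_i and Y_j differ at the rational points close to
    p, the slopes of I - J and I' - J' are d > 0 and d' < 0
    (triad_crossing).

    Put t = x - p and write K - I = h + a t, K - J = h + (a + d) t, and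
    likewise with primes. The equation that defines s = mu(x) is
    (K' - I')(s) / (K' - J')(s) = (K - I)(x) / (K - J)(x), and its solution is
    s = p + d h t / (d' h + (d' a - d a') t). Hence mu is continuous at p, and
    since its derivative d / d' there is negative, it exchanges the two sides
    of p. For each x the map f is affine, and it sends I(x), J(x), K(x) to
    I'(s), J'(s), K'(s) (branch_symmetry); being affine, it sends every affine
    combination of the former to the same affine combination of the latter
    (branch_comb_symmetry). This gives the implication from affine
    combinations to invariance.

    Conversely, let W be piecewise affine, equal to A on the right of p and to
    A' on the left. Because h and d are nonzero, A is an affine combination of
    I, J, K (affine_branch_comb). A single point x > p close to p then
    suffices: invariance and the previous paragraph show that at mu(x), which
    is different from p, A' agrees with the same combination of I', J', K'.
    They also agree at p by continuity, and two affine functions that agree at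
    two points are equal. *)

Set Implicit Arguments.
Unset Strict Implicit.
Unset Printing Implicit Defensive.

Import Order.TTheory GRing.Theory Num.Theory.
Import numFieldNormedType.Exports.

Local Open Scope classical_set_scope.
Local Open Scope ring_scope.

(** * Affine polynomials *)

Lemma affine_horner (R : comNzRingType) (A : {poly R}) (p x : R) :
  (size A <= 2)%N -> A.[x] = A.[p] + A`_1 * (x - p).
Proof.
move=> sA; rewrite !(horner_coef_wide _ sA) !big_ord_recl !big_ord0 /=; ring.
Qed.

Lemma size_affineB (R : nzRingType) (A B : {poly R}) :
  (size A <= 2)%N -> (size B <= 2)%N -> (size (A - B)%R <= 2)%N.
Proof.
by move=> sA sB; rewrite (leq_trans (size_polyD _ _)) // size_polyN geq_max sA.
Qed.

Lemma affine_eq2 (R : idomainType) (A B : {poly R}) (p s : R) :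
  (size A <= 2)%N -> (size B <= 2)%N -> s != p ->
  A.[p] = B.[p] -> A.[s] = B.[s] -> forall x, A.[x] = B.[x].
Proof.
move=> sA sB sp Ep Es x; move: Es.
rewrite (affine_horner p s sA) (affine_horner p s sB) Ep => /addrI slopes.
rewrite (affine_horner p x sA) (affine_horner p x sB) Ep.
by rewrite (mulIf _ slopes) // subr_eq0.
Qed.

Lemma affine_near_neq0 (R : realType) (u v p : R) :
  u != 0 -> \forall x \near p, u + v * (x - p) != 0.
Proof.
move=> u0; have cf : {for p, continuous (fun x => u + v * (x - p))}.
  apply: continuousD; first exact: cst_continuous.
  apply: continuousM; first exact: cst_continuous.
  apply: continuousB; [exact: cvg_id|exact: cst_continuous].
by apply: (cvgr_neq0 _ cf); rewrite subrr mulr0 addr0.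
Qed.

(** * Moebius maps *)

Lemma mobius_quotient_mx (R : realType) (A B : {poly R}) (x : R) :
  (size A <= 2)%N -> (size B <= 2)%N ->
  mobius (quotient_mx A B) x = A.[x] / B.[x].
Proof.
move=> sA sB; rewrite /mobius /quotient_mx !mxE /=.
by rewrite (affine_horner 0 x sA) (affine_horner 0 x sB) !horner_coef0 !subr0
  ![_`_1 * x + _]addrC.
Qed.

(** M maps the vector (s, 1) to (n, d), where n / d is the Moebius image of s,
    so M^-1 maps (n, d) back to (s, 1); only the vanishing of d could spoil the
    passage to quotients. *)
Lemma mobius_invmx (R : realType) (M : 'M[R]_2) (s : R) :
  M \in unitmx -> M 1 0 * s + M 1 1 != 0 ->
  mobius (invmx M) (mobius M s) = s.
Proof.
move=> uM dn0; pose v : 'cV[R]_2 := \col_i (if i == 0 then s else 1).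
have vK : invmx M *m (M *m v) = v by rewrite mulKmx.
have := congr1 (fun w : 'cV_2 => w 0 0) vK.
have := congr1 (fun w : 'cV_2 => w 1 0) vK.
rewrite !mxE !big_ord_recl !big_ord0 !mxE !big_ord_recl !big_ord0 !mxE /=.
have -> : lift ord0 ord0 = 1 :> 'I_2 by exact/val_inj.
have -> : ord0 = 0 :> 'I_2 by exact/val_inj.
move: (invmx M) => N E1 E0; rewrite /mobius.
set n := M 0 0 * s + _; set d := _ * s + _ in dn0 *.
have {}E0 : N 0 0 * n + N 0 1 * d = s by rewrite -[RHS]E0 /n /d; ring.
have {}E1 : N 1 0 * n + N 1 1 * d = 1 by rewrite -[RHS]E1 /n /d; ring.
have -> : N 0 0 * (n / d) + N 0 1 = s / d by rewrite -[in RHS]E0; field.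
have -> : N 1 0 * (n / d) + N 1 1 = d^-1.
  by rewrite -[RHS]mul1r -E1; field.
by rewrite invrK divfK.
Qed.

(** The determinant of a Moebius matrix does not change when the variable is
    translated, so it can be read off from the expansions at p. *)
Lemma det_quotient_mx (R : realType) (A B : {poly R}) (p : R) :
  (size A <= 2)%N -> (size B <= 2)%N ->
  \det (quotient_mx A B) = A`_1 * B.[p] - A.[p] * B`_1.
Proof.
move=> sA sB; rewrite (affine_horner 0 p sA) (affine_horner 0 p sB).
rewrite !horner_coef0 (expand_det_row _ 0) !big_ord_recl big_ord0.
rewrite /cofactor !det_mx11 /quotient_mx !mxE /= expr0 expr1; ring.
Qed.

(** * The symmetry of two branches that cross at a point *)

Definition crossing_branch (R : realType) (p c h : R) (T : branch R) : Prop :=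
  [/\ (size (brI T) <= 2)%N, (size (brJ T) <= 2)%N, (size (brK T) <= 2)%N
    & [/\ (brI T).[p] = c, (brJ T).[p] = c & (brK T).[p] = c + h]].

Definition opening (R : realType) (T : branch R) : R := (brI T)`_1 - (brJ T)`_1.

(** The quotient (mu(x) - p) / (x - p), obtained by solving the equation that
    defines mu after expanding all four affine functions at p. *)
Definition mu_slope (R : realType) (p h : R) (T T' : branch R) (x : R) : R :=
  opening T * h /
  (opening T' * h + (opening T' * (brK T - brI T)`_1 -
                     opening T * (brK T' - brI T')`_1) * (x - p)).

Lemma mu_slope_continuous (R : realType) (p h : R) (T T' : branch R) :
  h != 0 -> opening T' != 0 -> {for p, continuous (mu_slope p h T T')}.
Proof.
move=> h0 d0.
apply: continuousM; first exact: cst_continuous.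
apply: continuousV; first by rewrite subrr mulr0 addr0 mulf_neq0.
apply: continuousD; first exact: cst_continuous.
apply: continuousM; first exact: cst_continuous.
apply: continuousB; [exact: cvg_id|exact: cst_continuous].
Qed.

Lemma mu_slope_at (R : realType) (p h : R) (T T' : branch R) :
  h != 0 -> mu_slope p h T T' p = opening T / opening T'.
Proof.
by move=> h0; rewrite /mu_slope subrr mulr0 addr0 -mulf_div divff ?mulr1.
Qed.

(** The explicit s makes (K' - I')(s) and (K' - J')(s) proportional, with the
    same factor, to (K - I)(x) and (K - J)(x). Equality of the quotients
    identifies s with mu(x), and equality of the two factors makes f, which is
    defined from I and K alone, compatible with J as well. *)
Lemma branch_symmetry (R : realType) (p c h : R) (T T' : branch R) :
  crossing_branch p c h T -> crossing_branch p c h T' ->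
  h != 0 -> opening T != 0 -> opening T' != 0 ->
  \forall x \near p,
    let s := branch_mu T T' x in
    [/\ s = p + mu_slope p h T T' x * (x - p),
        branch_f T T' x (brI T).[x] = (brI T').[s],
        branch_f T T' x (brJ T).[x] = (brJ T').[s]
      & branch_f T T' x (brK T).[x] = (brK T').[s]].
Proof.
case: T T' => I J K [I' J' K'] [/= sI sJ sK [Ip Jp Kp]].
move=> [/= sI' sJ' sK' [Ip' Jp' Kp']] h0 d0 d0'.
have [sA sB] := (size_affineB sK sI, size_affineB sK sJ).
have [sA' sB'] := (size_affineB sK' sI', size_affineB sK' sJ').
have dE : opening (Branch I J K) = (K - J)`_1 - (K - I)`_1.
  by rewrite /opening /= !coefB; ring.
have dE' : opening (Branch I' J' K') = (K' - J')`_1 - (K' - I')`_1.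
  by rewrite /opening /= !coefB; ring.
have Ap : (K - I).[p] = h by rewrite hornerD hornerN Kp Ip; ring.
have Bp : (K - J).[p] = h by rewrite hornerD hornerN Kp Jp; ring.
have Ap' : (K' - I').[p] = h by rewrite hornerD hornerN Kp' Ip'; ring.
have Bp' : (K' - J').[p] = h by rewrite hornerD hornerN Kp' Jp'; ring.
have uM' : branch_mx (Branch I' J' K') \in unitmx.
  rewrite unitmxE /branch_mx /= (det_quotient_mx p sA' sB') Ap' Bp' unitfE.
  by rewrite [h * _]mulrC -mulrBl mulf_neq0 // -oppr_eq0 opprB -dE'.
near=> x.
have hA : h + (K - I)`_1 * (x - p) != 0 by near: x; exact: affine_near_neq0.
have hB : h + (K - J)`_1 * (x - p) != 0 by near: x; exact: affine_near_neq0.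
pose e := opening (Branch I' J' K') * (K - I)`_1 -
          opening (Branch I J K) * (K' - I')`_1.
have hD : opening (Branch I' J' K') * h + e * (x - p) != 0.
  by near: x; apply: affine_near_neq0; rewrite mulf_neq0.
set s := p + mu_slope p h (Branch I J K) (Branch I' J' K') x * (x - p).
have As : (K' - I').[s] = (K - I).[x] * (h * opening (Branch I' J' K')) /
    (opening (Branch I' J' K') * h + e * (x - p)).
  rewrite (affine_horner p s sA') (affine_horner p x sA) Ap Ap'.
  by rewrite /s /mu_slope -/e /= /e; field.
have Bs : (K' - J').[s] = (K - J).[x] * (h * opening (Branch I' J' K')) /
    (opening (Branch I' J' K') * h + e * (x - p)).
  rewrite (affine_horner p s sB') (affine_horner p x sB) Bp Bp'.
  rewrite /s /mu_slope -/e /= /e; move: hD; rewrite /e dE dE' => hD; field.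
  done.
have An0 : (K - I).[x] != 0 by rewrite (affine_horner p x sA) Ap.
have Bn0 : (K - J).[x] != 0 by rewrite (affine_horner p x sB) Bp.
have Bs0 : (K' - J').[s] != 0 by rewrite Bs !mulf_neq0 ?invr_eq0.
have muE : branch_mu (Branch I J K) (Branch I' J' K') x = s.
  rewrite /branch_mu {1}/branch_mx mobius_quotient_mx //=.
  have -> : (K - I).[x] / (K - J).[x] =
            mobius (branch_mx (Branch I' J' K')) s.
    rewrite mobius_quotient_mx //= As Bs; field.
    by rewrite hD h0 d0' Bn0.
  apply: mobius_invmx => //.
  rewrite /branch_mx /quotient_mx !mxE /=.
  by move: Bs0; rewrite (affine_horner 0 s sB') horner_coef0 subr0 addrC.
rewrite /= /branch_f muE.
have [EA EB] : K.[x] - I.[x] = (K - I).[x] /\ K.[x] - J.[x] = (K - J).[x].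
  by rewrite !hornerD !hornerN.
have [EA' EB'] : K'.[s] - I'.[s] = (K' - I').[s] /\
    K'.[s] - J'.[s] = (K' - J').[s].
  by rewrite !hornerD !hornerN.
have KI0 : K.[x] - I.[x] != 0 by rewrite EA.
split => //=; try by field.
(* J = K - (K - J): f is already known at K, and its linear part scales K - J
   to K' - J'. *)
have scale : (K'.[s] - I'.[s]) / (K.[x] - I.[x]) * (K.[x] - J.[x]) =
             K'.[s] - J'.[s].
  rewrite EA EB EA' EB' As Bs; field.
  by rewrite hD An0.
have -> : J'.[s] = K'.[s] - (K'.[s] - J'.[s]) by ring.
rewrite -scale; field.
done.
Unshelve. all: by end_near. Qed.

Lemma branch_mu_cvg (R : realType) (p c h : R) (T T' : branch R) :
  crossing_branch p c h T -> crossing_branch p c h T' ->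
  h != 0 -> opening T != 0 -> opening T' != 0 ->
  branch_mu T T' x @[x --> p] --> p.
Proof.
move=> cT cT' h0 d0 d0'.
have lim : p + mu_slope p h T T' x * (x - p) @[x --> p] --> p.
  rewrite -[X in _ --> X]addr0 -[X in _ --> p + X](mulr0 (mu_slope p h T T' p)).
  rewrite -[X in _ --> p + _ * X](subrr p).
  apply: cvgD; first exact: cvg_cst.
  apply: cvgM; first exact: mu_slope_continuous.
  by apply: cvgB; [exact: cvg_id|exact: cvg_cst].
apply: cvg_trans lim; apply: near_eq_cvg.
by apply: filterS (branch_symmetry cT cT' h0 d0 d0') => x [].
Qed.

(** The derivative of mu at p is the quotient of the two openings, which have
    opposite signs. *)
Lemma branch_mu_swap (R : realType) (p c h : R) (T T' : branch R) :
  crossing_branch p c h T -> crossing_branch p c h T' ->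
  h != 0 -> opening T * opening T' < 0 ->
  \forall x \near p,
    exists2 k, k < 0 & branch_mu T T' x - p = k * (x - p).
Proof.
move=> cT cT' h0 dd.
have := dd; rewrite mulr_lt0 => /and3P[d0 d0' _].
have neg : mu_slope p h T T' p < 0.
  by rewrite mu_slope_at // mulr_lt0 d0 invr_eq0 d0' invr_lt0 -neq0_mulr_lt0.
have neg_near : \forall x \near p, mu_slope p h T T' x < 0.
  exact: cvgr_lt (@mu_slope_continuous _ p h T T' h0 d0') _ neg.
have sym := branch_symmetry cT cT' h0 d0 d0'.
apply: filterS2 neg_near sym => x negx [-> _ _ _].
by exists (mu_slope p h T T' x); rewrite // addrC addKr.
Qed.

Lemma branch_mu_sides (R : realType) (p c h : R) (T T' : branch R) :
  crossing_branch p c h T -> crossing_branch p c h T' ->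
  h != 0 -> opening T * opening T' < 0 ->
  \forall x \near p, [/\ p <= x -> branch_mu T T' x <= p,
     x <= p -> p <= branch_mu T T' x & x != p -> branch_mu T T' x != p].
Proof.
move=> cT cT' h0 dd.
apply: filterS (branch_mu_swap cT cT' h0 dd) => x [k k0 E].
split=> xp.
- by rewrite -subr_le0 E nmulr_rle0 // subr_ge0.
- by rewrite -subr_ge0 E nmulr_rge0 // subr_le0.
- by rewrite -subr_eq0 E mulf_neq0 ?subr_eq0 // lt_eqF.
Qed.

(** * Affine combinations of the functions of a branch *)

Definition branch_comb (R : realType) (a b c : R) (T : branch R) : {poly R} :=
  a *: brI T + b *: brJ T + c *: brK T.

Lemma horner_branch_comb (R : realType) (a b c : R) (T : branch R) (x : R) :
  (branch_comb a b c T).[x] =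
  a * (brI T).[x] + b * (brJ T).[x] + c * (brK T).[x].
Proof. by rewrite !hornerD !hornerZ. Qed.

Lemma size_branch_comb (R : realType) (p c h a b d : R) (T : branch R) :
  crossing_branch p c h T -> (size (branch_comb a b d T) <= 2)%N.
Proof.
move=> [sI sJ sK _].
have sZ k (A : {poly R}) : (size A <= 2)%N -> (size (k *: A) <= 2)%N.
  exact: leq_trans (size_scale_leq _ _).
have sD (A B : {poly R}) :
    (size A <= 2)%N -> (size B <= 2)%N -> (size (A + B)%R <= 2)%N.
  by move=> sA sB; rewrite (leq_trans (size_polyD _ _)) // geq_max sA.
by rewrite /branch_comb !sD ?sZ.
Qed.

(** An affine map commutes with affine combinations; that the coefficients add
    up to 1 is what handles the constant term of f. *)
Lemma branch_comb_symmetry (R : realType) (p c h a b d : R) (T T' : branch R) :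
  crossing_branch p c h T -> crossing_branch p c h T' ->
  h != 0 -> opening T != 0 -> opening T' != 0 -> a + b + d = 1 ->
  \forall x \near p,
    branch_f T T' x (branch_comb a b d T).[x] =
    (branch_comb a b d T').[branch_mu T T' x].
Proof.
move=> cT cT' h0 d0 d0' sum1.
apply: filterS (branch_symmetry cT cT' h0 d0 d0') => x /= [_ fI fJ fK].
rewrite !horner_branch_comb -fI -fJ -fK /branch_f.
set r := _ / _; set q := (_ * _ - _) / _.
rewrite -[q in LHS]mul1r -sum1.
ring.
Qed.

(** The coefficient d of K is forced by the value at p, where I = J = c and
    K = c + h; the coefficient b of J is then forced by the slope. *)
Lemma affine_branch_comb (R : realType) (p c h : R) (T : branch R)
    (A : {poly R}) :
  crossing_branch p c h T -> h != 0 -> opening T != 0 -> (size A <= 2)%N ->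
  exists a b d : R,
    a + b + d = 1 /\ forall x, A.[x] = (branch_comb a b d T).[x].
Proof.
move=> [sI sJ sK [Ip Jp Kp]] h0; rewrite /opening => d0 sA.
pose d := (A.[p] - c) / h.
pose b := ((1 - d) * (brI T)`_1 + d * (brK T)`_1 - A`_1) /
  ((brI T)`_1 - (brJ T)`_1).
exists (1 - b - d), b, d; split; first by ring.
move=> x; rewrite horner_branch_comb (affine_horner p x sA).
rewrite (affine_horner p x sI) (affine_horner p x sJ) (affine_horner p x sK).
by rewrite Ip Jp Kp /b /d; field; rewrite h0.
Qed.

(** * One-sided affine pieces *)

(** A left piece is only given for x < p, and continuity extends it to p. This
    is needed because mu fixes p and because the two pieces of a function are
    compared there. *)
Lemma left_piece_at (R : realType) (p : R) (F : R -> R) (A : {poly R}) :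
  {for p, continuous F} -> left_piece p F A -> F p = A.[p].
Proof.
move=> cF [_ FA].
have FA' : {near p^'-, horner A =1 F} by apply: filterS FA => x + xp => ->.
have lF : F x @[x --> p^'-] --> F p by apply: cvg_at_left_filter.
have lA : A.[x] @[x --> p^'-] --> A.[p].
  by apply: cvg_at_left_filter; exact: continuous_horner.
apply: (cvg_unique _ lF); first exact: norm_hausdorff.
exact: cvg_trans (near_eq_cvg FA') lA.
Qed.

Lemma left_piece_closed (R : realType) (p : R) (F : R -> R) (A : {poly R}) :
  {for p, continuous F} -> left_piece p F A ->
  \forall x \near p, x <= p -> F x = A.[x].
Proof.
move=> cF FA; have Fp := left_piece_at cF FA.
by apply: filterS FA.2 => x FAx; rewrite le_eqVlt => /predU1P[->|/FAx].
Qed.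

Lemma rat_affine_poly (R : realType) (B : set R) (F : R -> R) :
  rat_affine_on B F ->
  exists2 A : {poly R}, (size A <= 2)%N & forall x, B x -> F x = A.[x].
Proof.
move=> [m [q E]]; exists (Poly [:: ratr q; ratr m]); first exact: size_Poly.
by move=> x /E ->; rewrite horner_Poly /= mul0r add0r.
Qed.

Lemma piecewise_affine_right (R : realType) (p : R) (F : R -> R) :
  piecewise_affine F -> exists A, right_piece p F A.
Proof.
move=> [_ /(_ p (p + 1))]; rewrite ltrDl ltr01 => /(_ isT).
case=> -[|y s] [[/= ps /eqP ls]].
  by move: ls => /eqP; rewrite -subr_eq0 opprD addNKr oppr_eq0 oner_eq0.
case/andP: ps => py _ /(_ 0%N isT) /rat_affine_poly[A sA FA].
exists A; split=> //; near=> x => px; apply: FA.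
rewrite /= in_itv /= px /=; apply/ltW.
by near: x; exact: lt_nbhsl.
Unshelve. all: by end_near. Qed.

Lemma piecewise_affine_left (R : realType) (p : R) (F : R -> R) :
  piecewise_affine F -> exists A, left_piece p F A.
Proof.
move=> [_ /(_ (p - 1) p)]; rewrite ltrBlDr ltrDl ltr01 => /(_ isT).
case=> s; case/lastP: s => [|s y] [[/= ps /eqP ls]].
  by move: ls => /eqP; rewrite -subr_eq0 addrAC subrr add0r oppr_eq0 oner_eq0.
move: ps ls; rewrite rcons_path last_rcons size_rcons => /andP[_ ly] yp.
move/(_ (size s) (ltnSn _)) => /rat_affine_poly[A sA FA].
exists A; split=> //; have lt_near : \forall x \near p, last (p - 1) s < x.
  by apply: lt_nbhsr; rewrite -[ltRHS]yp.
apply: filterS lt_near => x sx xp; apply: FA.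
rewrite /= nth_rcons ltnn eqxx yp -rcons_cons nth_rcons /= ltnS leqnn.
rewrite (_ : nth p (p - 1 :: s) (size s) = last (p - 1) s); last first.
  by rewrite (last_nth p).
by rewrite in_itv /= !ltW.
Qed.

(** * The branches of a triad *)

Lemma X_point_eq (R : realType) (Yi Yj : R -> R) (p : rat) :
  X_point Yi Yj p -> Yi (ratr p) = Yj (ratr p).
Proof. by move=> [e _ /seteqP[_ /(_ p erefl) []]]. Qed.

(** An X-point isolates p among the rational points of coincidence only, whence
    the restriction to rational x. *)
Lemma X_point_min_lt_max (R : realType) (Yi Yj : R -> R) (p : rat) :
  X_point Yi Yj p ->
  \forall x \near (ratr p : R), forall q : rat, x = ratr q -> x != ratr p ->
    (Yi \min Yj) x < (Yi \max Yj) x.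
Proof.
move=> [e e0 /seteqP[XP _]]; near=> x => q xq xp.
have YY : Yi x != Yj x.
  apply/eqP => YE; have /XP qp : [set x : rat |
      ratr p - e < ratr x < ratr p + e /\ Yi (ratr x) = Yj (ratr x)] q.
    rewrite /= -xq; split=> //; apply/andP; split; near: x.
      by apply: lt_nbhsr; rewrite ltrBlDr ltrDl.
    by apply: lt_nbhsl; rewrite ltrDl.
  by move: xp; rewrite xq qp eqxx.
by rewrite /= lt_max !gt_min !ltxx /= orbF orbC -neq_lt.
Unshelve. all: by end_near. Qed.

Lemma near_rat_right (R : realType) (p : R) (Q : R -> Prop) :
  (\forall x \near p, Q x) -> exists2 q : rat, p < ratr q & Q (ratr q).
Proof.
move=> /nbhs_ballP[e /= e0 pQ].
have [|q] := @rat_in_itvoo R p (p + e); first by rewrite ltrDl.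
rewrite in_itv /= => /andP[pq qe]; exists q => //; apply: pQ.
by rewrite /ball /= distrC gtr0_norm ?subr_gt0 // ltrBlDl.
Qed.

Lemma near_rat_left (R : realType) (p : R) (Q : R -> Prop) :
  (\forall x \near p, Q x) -> exists2 q : rat, ratr q < p & Q (ratr q).
Proof.
move=> /nbhs_ballP[e /= e0 pQ].
have [|q] := @rat_in_itvoo R (p - e) p; first by rewrite ltrBlDr ltrDl.
rewrite in_itv /= => /andP[eq qp]; exists q => //; apply: pQ.
by rewrite /ball /= gtr0_norm ?subr_gt0 // ltrBlDr -ltrBlDl.
Qed.

Lemma continuous_min_max (R : realType) (Yi Yj : R -> R) :
  continuous Yi -> continuous Yj ->
  continuous (Yi \max Yj) /\ continuous (Yi \min Yj).
Proof.
move=> ci cj; split=> x; [apply: continuous_max|apply: continuous_min];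
  by [exact: ci|exact: cj].
Qed.

(** One rational point on each side of p, close enough to p, is enough to
    exclude that I - J or I' - J' vanishes identically, and it fixes the sign
    of their slopes. *)
Lemma triad_crossing (R : realType) (Yi Yj Y : R -> R) (p : rat)
    (T T' : branch R) :
  triad Yi Yj Y p ->
  right_branch (ratr p) (Yi \max Yj) (Yi \min Yj) Y T ->
  left_branch (ratr p) (Yi \max Yj) (Yi \min Yj) Y T' ->
  exists c h : R,
    [/\ crossing_branch (ratr p) c h T, crossing_branch (ratr p) c h T',
        0 < h, 0 < opening T & opening T' < 0].
Proof.
move=> [[ci _] [cj _] [cY _] hX hY _ _ _] [hU hL hK] [hU' hL' hK'].
have [cU cL] := continuous_min_max ci cj.
have Yij := X_point_eq hX.
pose c := Yi (ratr p); pose h := Y (ratr p) - c.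
have Up : (Yi \max Yj) (ratr p) = c by rewrite /= -Yij maxxx.
have Lp : (Yi \min Yj) (ratr p) = c by rewrite /= -Yij minxx.
have Kp : Y (ratr p) = c + h by rewrite addrC subrK.
have cT : crossing_branch (ratr p) c h T.
  case: hU hL hK => [sU fU] [sL fL] [sK fK]; split=> //.
  by split; [rewrite -(nbhs_singleton fU)|rewrite -(nbhs_singleton fL)
            |rewrite -(nbhs_singleton fK)].
have cT' : crossing_branch (ratr p) c h T'.
  split; [exact: hU'.1|exact: hL'.1|exact: hK'.1|split].
  - by rewrite -(left_piece_at (cU _) hU').
  - by rewrite -(left_piece_at (cL _) hL').
  - by rewrite -(left_piece_at (cY _) hK').
have lt := X_point_min_lt_max hX.
have gapE (S : branch R) x : crossing_branch (ratr p) c h S ->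
    (brI S).[x] - (brJ S).[x] = opening S * (x - ratr p).
  move=> [sI sJ _ [Ip Jp _]].
  rewrite (affine_horner (ratr p) x sI) (affine_horner (ratr p) x sJ) Ip Jp.
  by rewrite /opening; ring.
exists c, h; split=> //; first by rewrite subr_gt0.
  have [q pq [[ltq Uq] Lq]] :=
    near_rat_right (filterI (filterI lt hU.2) hL.2).
  have := ltq q erefl; rewrite gt_eqF // => /(_ isT).
  rewrite Uq ?ltW // Lq ?ltW // -subr_gt0 gapE // pmulr_lgt0 // subr_gt0 //.
have [q qp [[ltq Uq] Lq]] := near_rat_left (filterI (filterI lt hU'.2) hL'.2).
have := ltq q erefl; rewrite lt_eqF // => /(_ isT).
by rewrite Uq // Lq // -subr_gt0 gapE // nmulr_lgt0 // subr_lt0.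
Qed.

Lemma affine_combination_nearP (R : realType) (p : R) (W U L Y : R -> R)
    (T T' : branch R) :
  continuous U -> continuous L -> continuous Y ->
  right_branch p U L Y T -> left_branch p U L Y T' ->
  affine_combination_near p W U L Y <->
  exists a b c : R, [/\ a + b + c = 1,
    \forall x \near p, p <= x -> W x = (branch_comb a b c T).[x]
    & \forall x \near p, x <= p -> W x = (branch_comb a b c T').[x]].
Proof.
move=> cU cL cY [[_ UI] [_ LJ] [_ YK]] [hU' hL' hK'].
have UI' := left_piece_closed (cU p) hU'.
have LJ' := left_piece_closed (cL p) hL'.
have YK' := left_piece_closed (cY p) hK'.
split=> -[a [b [c [sum1]]]]; [move=> WE|move=> WR WL]; exists a, b, c.
  split=> //; near=> x => px; rewrite horner_branch_comb.
    rewrite (near WE x) // (near UI x) // (near LJ x) // (near YK x) //.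
  by rewrite (near WE x) // (near UI' x) // (near LJ' x) // (near YK' x).
split=> //; near=> x; have [px|/ltW xp] := leP p x.
  rewrite (near WR x) // horner_branch_comb.
  by rewrite (near UI x) // (near LJ x) // (near YK x).
rewrite (near WL x) // horner_branch_comb.
by rewrite (near UI' x) // (near LJ' x) // (near YK' x).
Unshelve. all: by end_near. Qed.

Unset Implicit Arguments.

Theorem lemma10 (R : realType) (Yi Yj Y : R -> R) (p : rat)
    (T T' : branch R)
    (hOmega : triad Yi Yj Y p)
    (hT : right_branch (ratr p) (Yi \max Yj) (Yi \min Yj) Y T)
    (hT' : left_branch (ratr p) (Yi \max Yj) (Yi \min Yj) Y T')
    (W : R -> R) (hW : piecewise_affine W)
    (hWreg : regular_near_except W (ratr p)) :
  (\forall x \near (ratr p : R),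
     W (sym_mu (ratr p) T T' x) = sym_f (ratr p) T T' x (W x))
  <->
  affine_combination_near (ratr p) W (Yi \max Yj) (Yi \min Yj) Y.
Proof.
have [c [h [cT cT' h_gt0 d_gt0 d_lt0]]] := triad_crossing hOmega hT hT'.
have [[ci _] [cj _] [cY _] _ _ _ _ _] := hOmega.
have [cU cL] := continuous_min_max ci cj.
have h0 : h != 0 by rewrite gt_eqF.
have d0 : opening T != 0 by rewrite gt_eqF.
have d0' : opening T' != 0 by rewrite lt_eqF.
have dd : opening T * opening T' < 0 by rewrite pmulr_rlt0.
have dd' : opening T' * opening T < 0 by rewrite mulrC.
have sideR := branch_mu_sides cT cT' h0 dd.
have muR := branch_mu_cvg cT cT' h0 d0 d0'.
rewrite (affine_combination_nearP W cU cL cY hT hT').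
split=> [sym | [a [b [d [sum1 WR WL]]]]]; last first.
  have sideL := branch_mu_sides cT' cT h0 dd'.
  have muL := branch_mu_cvg cT' cT h0 d0' d0.
  have WmuR := muR _ WL; have WmuL := muL _ WR.
  have fR := branch_comb_symmetry cT cT' h0 d0 d0' sum1.
  have fL := branch_comb_symmetry cT' cT h0 d0' d0 sum1.
  near=> x; rewrite /sym_mu /sym_f; case: leP => [px|/ltW xp].
    have [mu_le _ _] : [/\ ratr p <= x -> branch_mu T T' x <= ratr p,
        x <= ratr p -> ratr p <= branch_mu T T' x
        & x != ratr p -> branch_mu T T' x != ratr p] by near: x.
    have -> : W x = (branch_comb a b d T).[x] by move: px; near: x.
    rewrite (near fR x) //.
    by move: (mu_le px); near: x.
  have [_ mu_ge _] : [/\ ratr p <= x -> branch_mu T' T x <= ratr p,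
      x <= ratr p -> ratr p <= branch_mu T' T x
      & x != ratr p -> branch_mu T' T x != ratr p] by near: x.
  have -> : W x = (branch_comb a b d T').[x] by move: xp; near: x.
  rewrite (near fL x) //.
  by move: (mu_ge xp); near: x.
have [A [sA WA]] := piecewise_affine_right (ratr p) hW.
have [A' hA'] := piecewise_affine_left (ratr p) hW.
have WA' := left_piece_closed (hW.1 (ratr p)) hA'.
have [a [b [d [sum1 AE]]]] := affine_branch_comb cT h0 d0 sA.
have fR := branch_comb_symmetry cT cT' h0 d0 d0' sum1.
have [q pq [[[[fq [mu_le _ mu_neq]] Wmuq] symq] Wq]] := near_rat_right
  (filterI (filterI (filterI (filterI fR sideR) (muR _ WA')) sym) WA).
(* q is a point to the right of p where everything holds; its image by mu and p
   are the two points that determine A'. *)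
have A'E : forall x, A'.[x] = (branch_comb a b d T').[x].
  have sC' := size_branch_comb a b d cT'.
  apply: (affine_eq2 hA'.1 sC' (mu_neq _)); first by rewrite gt_eqF.
    rewrite -(nbhs_singleton WA') // (nbhs_singleton WA) // AE.
    have [_ _ _ [Ip Jp Kp]] := cT; have [_ _ _ [Ip' Jp' Kp']] := cT'.
    by rewrite !horner_branch_comb Ip Jp Kp Ip' Jp' Kp'.
  rewrite -Wmuq ?mu_le ?ltW // -fq -AE -Wq ?ltW //.
  by move: symq; rewrite /sym_mu /sym_f ltW.
exists a, b, d; split=> //.
  by apply: filterS WA => x + px => ->; rewrite ?AE.
by apply: filterS WA' => x + px => ->; rewrite ?A'E.
Unshelve. all: by end_near. Qed.
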